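(* Let $R$ be a semiring which is additively generated by its group of units $R^\times$, and let $V$ be an $R$-module which lacks zero sums. Then $\operatorname{dsoc}(V)$ is the direct sum of all indecomposable direct summands of $V$, and the additive monoid $$\operatorname{dsoc}(V)_0' := (V\setminus \operatorname{dsoc}(V)) \cup \{0_V\}$$ is an $R$-submodule of $V$. (But if there are infinitely many such indecomposable direct summands, $\operatorname{dsoc}(V)$ need not be a direct summand of $V$.)
   Context: A semiring $(R,+,\cdot,0_R,1_R)$: $(R,+,0_R)$ is a commutative monoid, $(R,\cdot,1_R)$ is a (not necessarily commutative) monoid, and multiplication distributes over addition. $R^\times$ denotes the group of multiplicatively invertible elements; $R$ is additively generated by $R^\times$ if every element of $R$ is a finite (possibly empty) sum of elements of $R^\times$. A (left) $R$-module $V$ is a commutative monoid $(V,+,0_V)$ with scalar multiplication $R\times V\to V$ such that $r(v+w)=rv+rw$, $(r_1+r_2)v=r_1v+r_2v$, $(r_1r_2)v=r_1(r_2v)$, $1_Rv=v$, and $0_Rv=r0_V=0_V$. No subtraction is assumed. $V$ lacks zero sums if $v_1+v_2=0_V$ implies $v_1=v_2=0_V$ for all $v_1,v_2\in V$. For submodules $T,W$ of $V$, $V=T\oplus W$ means every element of $V$ is uniquely of the form $t+w$ with $t\in T$, $w\in W$; a direct summand of $V$ is a submodule $T$ such that $V=T\oplus W$ for some submodule $W$. A sum of an arbitrary family of submodules is direct if each of its elements has a unique expression as a sum of elements of the submodules, almost all zero. A module $X\neq\{0\}$ is indecomposable if there is no decomposition $X=W_1\oplus W_2$ with $W_1,W_2\neq\{0\}$.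 The decomposition socle $\operatorname{dsoc}(V)$ is the sum of all indecomposable direct summands of $V$. *)

(* Defs.v *)
From HB Require Import structures.
From mathcomp Require Import all_boot all_order all_algebra.
From mathcomp Require Import boolp classical_sets functions cardinality fsbigop.

Set Implicit Arguments.
Unset Strict Implicit.
Unset Printing Implicit Defensive.

Import GRing.Theory.

Local Open Scope classical_set_scope.
Local Open Scope ring_scope.

(* [GRing.unit] is only available for rings, hence this semiring version. *)
Definition semiring_unit (R : pzSemiRingType) (u : R) : Prop :=
  exists w : R, u * w = 1 /\ w * u = 1.

Definition additively_generated_by_units (R : pzSemiRingType) : Prop :=
  forall r : R, exists s : seq R,
    (forall u, u \in s -> semiring_unit u) /\ r = \sum_(u <- s) u.

Definition lacks_zero_sums (V : nmodType) : Prop :=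
  forall v w : V, v + w = 0 -> v = 0 /\ w = 0.

Section Submodules.
Context (R : pzSemiRingType) (V : lSemiModType R).

Definition is_submodule (T : set V) : Prop := GRing.subsemimod_closed [in T].

(* X = T (+) W, where the submodules T and W of X are submodules of the ambient
   V contained in X. *)
Definition is_dsum (X T W : set V) : Prop :=
  [/\ is_submodule T, is_submodule W, T `<=` X, W `<=` X &
      forall x, X x -> exists! p : V * V, [/\ T p.1, W p.2 & x = p.1 + p.2]].

Definition direct_summand (T : set V) : Prop :=
  exists W : set V, is_dsum setT T W.

Definition indecomposable (X : set V) : Prop :=
  [/\ is_submodule X, X <> [set 0] &
      ~ exists W1 W2 : set V,
          [/\ is_dsum X W1 W2, W1 <> [set 0] & W2 <> [set 0]]].

Section Families.
Context (I : choiceType) (D : set I) (W : I -> set V).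

(* The family f expresses v as a sum of elements of the W i, for i in D, almost
   all zero. Setting f to 0 outside D makes f unique as a function on I exactly
   when the expression is unique; finiteness is required because [\sum_(i \in D)]
   is 0 by convention on an infinite support. *)
Definition expression (v : V) (f : I -> V) : Prop :=
  [/\ forall i, D i -> W i (f i),
      forall i, ~ D i -> f i = 0,
      finite_set (D `&` [set i | f i <> 0]) &
      v = \sum_(i \in D) f i].

Definition family_sum : set V := [set v | exists f, expression v f].

Definition family_direct : Prop :=
  forall v, family_sum v -> exists! f, expression v f.

Definition is_family_dsum (X : set V) : Prop :=
  X = family_sum /\ family_direct.

End Families.
End Submodules.

Section DecompositionSocle.
Context (R : pzSemiRingType) (V : lSemiModType R).

Definition indec_summands : set (set V) :=
  [set T | direct_summand T /\ indecomposable T].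

(* The family of indecomposable direct summands is indexed by itself. *)
Definition dsoc : set V := family_sum indec_summands id.

Definition dsoc0' : set V := (setT `\` dsoc) `|` [set 0].

End DecompositionSocle.

Arguments indec_summands {R} V.
Arguments dsoc {R} V.
Arguments dsoc0' {R} V.

(* Main.v *)
Require Import Defs.
From HB Require Import structures.
From mathcomp Require Import all_boot all_order all_algebra.
From mathcomp Require Import boolp classical_sets functions cardinality fsbigop.

(* If V lacks zero sums, a direct summand T of V is summand absorbing: u + v in
   T forces u, v in T, because the components of u and v in a complement of T
   add up to 0. Hence V = T (+) W induces S = (S /\ T) (+) (S /\ W) on every
   other direct summand S, so that an indecomposable S lies in T or in W, and
   two distinct indecomposable direct summands meet in 0. This yields
   directness. Sums of direct summands, and thus dsoc(V), are also summand
   absorbing; hence the complement of dsoc(V) is closed under addition, and it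
   is closed under units, hence under sums of units.

   For the last assertion take R = N and V = N^N: the indecomposable direct
   summands are the coordinate lines, and dsoc(V) consists of the sequences with
   finite support. A complement of dsoc(V) is summand absorbing, so a nonzero
   element of it would put a basis vector in it; thus it is 0. *)

Set Implicit Arguments.
Unset Strict Implicit.
Unset Printing Implicit Defensive.

Local Open Scope classical_set_scope.
Local Open Scope ring_scope.
Import GRing.Theory.

(** * Sums of families of submodules *)

Section FamilySum.
Context {R : pzSemiRingType} {V : lSemiModType R}.

Lemma is_submoduleP (T : set V) :
  is_submodule T <->
  [/\ T 0, forall u v, T u -> T v -> T (u + v) & forall a v, T v -> T (a *: v)].
Proof.
split=> [[[T0 TD] TZ]|[T0 TD TZ]].
  split=> [|u v Tu Tv|a v Tv]; first exact: set_mem.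
    by apply: set_mem; apply: TD; apply: mem_set.
  by apply: set_mem; apply: TZ; apply: mem_set.
split; first split; first exact: mem_set.
  by move=> u v /set_mem Tu /set_mem Tv; apply: mem_set; apply: TD.
by move=> a v /set_mem Tv; apply: mem_set; apply: TZ.
Qed.

Context {I : choiceType} {D : set I} {W : I -> set V}.
Hypothesis Wmod : forall i, D i -> is_submodule (W i).

Lemma fsum_submodule (S : set V) (A : set I) (f : I -> V) :
  is_submodule S -> (forall i, A i -> S (f i)) -> S (\sum_(i \in A) f i).
Proof.
move=> /is_submoduleP [S0 SD _] Sf.
(* On an infinite support the sum is 0 by convention, and 0 lies in [S]. *)
case: finite_supportP => [_|X XA _ _]; first by rewrite big_nil.
by rewrite big_seq; apply: big_ind => // i iX; apply/Sf/XA.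
Qed.

Lemma family_sum0 : family_sum D W 0.
Proof.
exists (fun=> 0); split=> //.
- by move=> i /Wmod/is_submoduleP[].
- by apply: (sub_finite_set (B := set0)) => // i [].
- by rewrite fsbig1.
Qed.

Lemma family_sumD (u v : V) :
  family_sum D W u -> family_sum D W v -> family_sum D W (u + v).
Proof.
move=> [f [Wf f0 finf ->]] [g [Wg g0 fing ->]].
(* The union of both supports is a common finite index set, over which the sum of [f i + g i] can be
   split. *)
pose A := (D `&` [set i | f i <> 0]) `|` (D `&` [set i | g i <> 0]).
have finA : finite_set A by rewrite finite_setU.
have AD : A `<=` D by move=> i [[]|[]].
have sumA (h : I -> V) : (forall i, D i -> ~ A i -> h i = 0) ->
    \sum_(i \in D) h i = \sum_(i \in A) h i.
  by move=> h0; rewrite [RHS](@fsbig_widen _ _ _ _ A D)// => i [Di /(h0 i Di)].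
have f0A i : D i -> ~ A i -> f i = 0.
  by move=> Di NAi; apply: contrapT => fi0; apply: NAi; left.
have g0A i : D i -> ~ A i -> g i = 0.
  by move=> Di NAi; apply: contrapT => gi0; apply: NAi; right.
exists (fun i => f i + g i); split.
- by move=> i Di; have /is_submoduleP[_ + _] := Wmod Di; apply; auto.
- by move=> i NDi; rewrite f0 ?g0 ?addr0.
- apply: sub_finite_set finA => i [Di fgi]; apply: contrapT => NAi.
  by apply: fgi; rewrite f0A ?g0A ?addr0.
rewrite !sumA ?fsbig_split// => i Di NAi.
by rewrite f0A ?g0A ?addr0.
Qed.

Lemma sub_family_sum i : D i -> W i `<=` family_sum D W.
Proof.
move=> Di v Wv; exists (fun j => if j == i then v else 0); split.
- by move=> j /Wmod/is_submoduleP[W0 _ _]; case: eqP => [->|].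
- by move=> j NDj; case: eqP => // ji; case: NDj; rewrite ji.
- by apply: sub_finite_set (finite_set1 i) => j [_]/=; case: eqP.
rewrite -(@fsbig_widen _ _ _ _ [set i]) ?fsbig_set1 ?eqxx//.
- by move=> j ->.
- by move=> j [_ /=]; case: eqP.
Qed.

(** Induction that adds one component at a time, so that [P] need not be shown additive. *)
Lemma family_sum_ind (P : V -> Prop) :
  P 0 -> (forall i u v, D i -> W i u -> P v -> P (u + v)) ->
  forall v, family_sum D W v -> P v.
Proof.
move=> P0 PD _ [f [Wf _ _ ->]].
case: finite_supportP => [_|X XD _ _]; first by rewrite big_nil.
rewrite big_seq; apply: big_rec => // i v iX Pv.
by have Di := XD _ iX; apply: (PD i) Di (Wf _ Di) Pv.
Qed.

Lemma family_sum_submodule : is_submodule (family_sum D W).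
Proof.
apply/is_submoduleP; split=> [||a]; [exact: family_sum0|exact: family_sumD|].
apply: family_sum_ind => [|i u v Di Wu aSv].
  by rewrite scaler0; exact: family_sum0.
rewrite scalerDr; apply: family_sumD => //; apply: (sub_family_sum Di).
by have /is_submoduleP[_ _ ] := Wmod Di; apply.
Qed.

(** Isolates the component at [i]. When [S] is a complement of [W i], this determines [f i] from
    [v]. *)
Lemma expression_split (i : I) (S : set V) (v : V) (f : I -> V) :
  D i -> is_submodule S -> (forall j, D j -> j <> i -> W j `<=` S) ->
  expression D W v f -> exists2 w, S w & v = f i + w.
Proof.
move=> Di Smod WS [Wf _ finf ->].
have Sf j : D j -> j <> i -> S (f j) by move=> Dj ji; apply: (WS j) => //; auto.
(* If [f i = 0], then [i] is not in the support and cannot be extracted from the sum; the whole sum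
   then serves as [w]. *)
have [fi0|fiN0] := pselect (f i = 0).
  exists (\sum_(j \in D) f j); last by rewrite fi0 add0r.
  apply: fsum_submodule => // j Dj.
  have [->|/Sf] := pselect (j = i); last exact.
  by rewrite fi0; case/is_submoduleP: Smod.
rewrite fsbig_supp (fsbigD1 i)//.
eexists; last reflexivity.
by apply: fsum_submodule => // j [[Dj _] ji]; apply: Sf.
Qed.

End FamilySum.

(** * Direct summands and absorption *)

Section DirectSums.
Context {R : pzSemiRingType} {V : lSemiModType R}.

Definition summand_absorbing (S : set V) : Prop :=
  forall u v, S (u + v) -> S u.

Lemma dsum_split (X T W : set V) (x : V) :
  is_dsum X T W -> X x -> exists t w, [/\ T t, W w & x = t + w].
Proof. by case=> _ _ _ _ /[apply] -[[t w] [/= ? _]]; exists t, w. Qed.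

Lemma dsum_inj (T W : set V) (t w t' w' : V) :
  is_dsum setT T W -> T t -> W w -> T t' -> W w' ->
  t + w = t' + w' -> t = t' /\ w = w'.
Proof.
case=> _ _ _ _ /(_ (t + w) I) [p [_ uniqp]] Tt Ww Tt' Ww' e.
have e1 := uniqp (t, w) (And3 Tt Ww erefl).
have e2 := uniqp (t', w') (And3 Tt' Ww' e).
by have [-> ->] : (t, w) = (t', w') by rewrite -e1 -e2.
Qed.

Lemma dsumC (T W : set V) : is_dsum setT T W -> is_dsum setT W T.
Proof.
move=> dTW; have [Tmod Wmod _] := dTW; split=> // x _.
have [t [w [Tt Ww ->]]] := dsum_split dTW (I : setT x).
exists (w, t); split=> /=; first by rewrite addrC.
move=> [w' t'] /= [Ww' Tt' e].
by have [-> ->] := dsum_inj dTW Tt Ww Tt' Ww' (etrans e (addrC _ _)).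
Qed.

Lemma dsum_capI (T W : set V) (v : V) :
  is_dsum setT T W -> T v -> W v -> v = 0.
Proof.
move=> dTW Tv Wv; have [/is_submoduleP[T0 _ _] /is_submoduleP[W0 _ _] _ _ _] := dTW.
by have [] := dsum_inj dTW Tv W0 T0 Wv (addrC _ _).
Qed.

Lemma indecomposable_nonzero (X : set V) :
  indecomposable X -> exists2 x, X x & x <> 0.
Proof.
move=> [/is_submoduleP[X0 _ _] Xnz _]; apply: contrapT => H; apply: Xnz.
apply/seteqP; split=> [x Xx|x ->//]; apply: contrapT => x0.
by apply: H; exists x.
Qed.

Hypothesis lzs : lacks_zero_sums V.

Lemma dsum_summand_absorbing (T W : set V) :
  is_dsum setT T W -> summand_absorbing T.
Proof.
move=> dTW u v; have [/is_submoduleP[_ TD _] /is_submoduleP[W0 WD _] _ _ _] := dTW.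
have [t [w [Tt Ww ->]]] := dsum_split dTW (I : setT u).
have [t' [w' [Tt' Ww' ->]]] := dsum_split dTW (I : setT v).
rewrite addrACA => Ts.
have [_ /lzs[w0 _]] := dsum_inj dTW (TD _ _ Tt Tt') (WD _ _ Ww Ww')
  Ts W0 (esym (addr0 _)).
by rewrite w0 addr0.
Qed.

(** Absorption puts both components of an element of [S] back into [S]; uniqueness is inherited from
    [V]. *)
Lemma dsum_setI (S T W : set V) :
  is_submodule S -> summand_absorbing S -> is_dsum setT T W ->
  is_dsum S (S `&` T) (S `&` W).
Proof.
move=> Smod Sabs dTW; have [Tmod Wmod _] := dTW.
have Imod A : is_submodule A -> is_submodule (S `&` A).
  move: Smod => /is_submoduleP[S0 SD SZ] /is_submoduleP[A0 AD AZ].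
  apply/is_submoduleP; split=> [//|u v [Su Au] [Sv Av]|a v [Sv Av]]; split; auto.
split; [exact: Imod|exact: Imod|exact: subIsetl|exact: subIsetl|].
move=> x Sx; have [t [w [Tt Ww e]]] := dsum_split dTW (I : setT x).
exists (t, w); split=> /=.
  split=> //; split=> //; first by apply: (Sabs _ w); rewrite -e.
  by apply: (Sabs _ t); rewrite addrC -e.
move=> [t' w'] /= [[_ Tt'] [_ Ww']]; rewrite e => e'.
by have [-> ->] := dsum_inj dTW Tt Ww Tt' Ww' e'.
Qed.

Lemma indecomposable_sub (S T W : set V) :
  indecomposable S -> summand_absorbing S -> is_dsum setT T W ->
  S `<=` T \/ S `<=` W.
Proof.
move=> [Smod _ Sind] Sabs dTW; have dS := dsum_setI Smod Sabs dTW.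
have [ST0|ST0] := pselect (S `&` T = [set 0]).
  right=> x /(dsum_split dS)[t [w [+ [_ Ww] ->]]].
  by rewrite ST0 => ->; rewrite add0r.
have [SW0|SW0] := pselect (S `&` W = [set 0]).
  left=> x /(dsum_split dS)[t [w [[_ Tt] + ->]]].
  by rewrite SW0 => ->; rewrite addr0.
by case: Sind; exists (S `&` T), (S `&` W).
Qed.

(** * Indecomposable direct summands *)

Lemma indec_summand_submodule (T : set V) : indec_summands V T -> is_submodule T.
Proof. by case=> _ []. Qed.

Lemma indec_summand_absorbing (T : set V) :
  indec_summands V T -> summand_absorbing T.
Proof. by case=> [[W /dsum_summand_absorbing]]. Qed.

Lemma indec_summand_eq (S T : set V) (v : V) :
  indec_summands V S -> indec_summands V T -> S v -> T v -> v <> 0 -> S = T.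
Proof.
move=> DS DT Sv Tv v0.
have sub A B : indec_summands V A -> indec_summands V B -> A v -> B v -> A `<=` B.
  move=> DA DB Av Bv; have [[W dBW] _] := DB; have [_ Aind] := DA.
  have [//|AW] := indecomposable_sub Aind (indec_summand_absorbing DA) dBW.
  (* The alternative [A] inside [W] would put [v] into both [B] and [W], which meet in 0. *)
  by case: v0; apply: (dsum_capI dBW) => //; apply: AW.
by apply/seteqP; split; apply: sub.
Qed.

Lemma indec_summand_sub_compl (S T W : set V) :
  indec_summands V S -> indec_summands V T -> is_dsum setT T W ->
  S <> T -> S `<=` W.
Proof.
move=> DS DT dTW ST; have [_ Sind] := DS.
have [ST'|//] := indecomposable_sub Sind (indec_summand_absorbing DS) dTW.
have [v Sv v0] := indecomposable_nonzero Sind.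
by case: ST; apply: indec_summand_eq v0 => //; apply: ST'.
Qed.

(** Two expressions are compared at each [T]: all other indecomposable summands lie in one
    complement [W] of [T], so [f T] and [g T] are both the [T]-component of [v]. *)
Lemma indec_summands_direct : family_direct (indec_summands V) id.
Proof.
move=> v [f Ef]; exists f; split=> // g Eg; apply/funext => T.
have [DT|NDT] := pselect (indec_summands V T); last first.
  by case: Ef Eg => _ f0 _ _ [_ g0 _ _]; rewrite f0 ?g0.
have [[W dTW] _] := DT; have [_ Wmod _] := dTW.
have WS j : indec_summands V j -> j <> T -> id j `<=` W.
  by move=> Dj; exact: indec_summand_sub_compl.
have [w Ww ef] := expression_split DT Wmod WS Ef.
have [w' Ww' eg] := expression_split DT Wmod WS Eg.
have [Wf _ _ _] := Ef; have [Wg _ _ _] := Eg.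
by have [] := dsum_inj dTW (Wf _ DT) Ww (Wg _ DT) Ww' (etrans (esym ef) eg).
Qed.

(** The [W]-component of an element [t + s] of the sum is that of [s], hence lies in [S] by
    absorption. If [t + s = u + v], it is the sum of the [W]-components of [u] and [v], so that of
    [u] lies in [S] as well. *)
Lemma sumset_absorbing (S T W : set V) :
  summand_absorbing S -> is_dsum setT T W ->
  summand_absorbing [set t + s | t in T & s in S].
Proof.
move=> Sabs dTW u v; have [/is_submoduleP[_ TD _] /is_submoduleP[_ WD _] _ _ _] := dTW.
have [t [w [Tt Ww ->]]] := dsum_split dTW (I : setT u).
have [t' [w' [Tt' Ww' ->]]] := dsum_split dTW (I : setT v).
move=> [t1 Tt1 [s + e]].
have [t2 [w2 [Tt2 Ww2 es]]] := dsum_split dTW (I : setT s).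
rewrite es in e *; rewrite addrC => /Sabs Sw2; exists t => //; exists w => //.
apply: (Sabs _ w').
have [|_ ->//] := dsum_inj dTW (TD _ _ Tt Tt') (WD _ _ Ww Ww')
  (TD _ _ Tt1 Tt2) Ww2.
by rewrite addrACA -e addrA.
Qed.

(** * The decomposition socle and its complement *)

Lemma dsoc_submodule : is_submodule (dsoc V).
Proof. exact: family_sum_submodule indec_summand_submodule. Qed.

Lemma dsoc_absorbing : summand_absorbing (dsoc V).
Proof.
have [d0 dD _] := (is_submoduleP _).1 dsoc_submodule.
(* Each element lies in a finite sum of indecomposable summands; the induction carries this sum [S]
   along, together with its absorption. *)
suff H x : dsoc V x -> exists S, [/\ S x, summand_absorbing S & S `<=` dsoc V].
  by move=> u v /H[S [Suv Sabs Sd]]; apply/Sd/(Sabs u v).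
move: x; apply: family_sum_ind => [|T u v DT Tu [S [Sv Sabs Sd]]].
  (* That the zero submodule is absorbing is the absence of zero sums. *)
  by exists [set 0]; split=> [//|u v /lzs[]//|_ ->].
have [[W dTW] _] := DT; exists [set t + s | t in T & s in S]; split.
- by exists u => //; exists v.
- exact: sumset_absorbing dTW.
move=> _ [t Tt [s Ss <-]]; apply: dD; last exact: Sd.
exact: (sub_family_sum indec_summand_submodule DT).
Qed.

Hypothesis gen : additively_generated_by_units R.

Lemma dsoc0'_submodule : is_submodule (dsoc0' V).
Proof.
have [_ _ dZ] := (is_submoduleP _).1 dsoc_submodule.
have d'D u v : dsoc0' V u -> dsoc0' V v -> dsoc0' V (u + v).
  move=> [[_ Nu]|->]; last by rewrite add0r.
  move=> _; left; split=> //.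
  exact: contra_not (dsoc_absorbing (v := v)) Nu.
apply/is_submoduleP; split=> [|//|a v d'v]; first by right.
have [s [sunit ->]] := gen a; rewrite scaler_suml big_seq.
apply: big_ind => [|//|u /sunit[w [_ wu]]]; first by right.
case: d'v => [[_ Nv]|->]; last by right; rewrite scaler0.
left; split=> // duv; apply: Nv.
(* With [w] inverse to the unit [u], [v = w *: (u *: v)] would lie in the socle. *)
by rewrite -[v]scale1r -wu -scalerA; apply: dZ.
Qed.

End DirectSums.

(** * Commutative monoids as modules over the natural numbers *)

Section NatModule.
Variable M : nmodType.

(** A separate name for [M], to which the action by multiples is attached. *)
Definition nat_module : Type := M.

HB.instance Definition _ := GRing.Nmodule.on nat_module.

Let scale (n : nat) (v : nat_module) : nat_module := v *+ n.

Fact nat_scaleA a b v : scale a (scale b v) = scale (a * b) v.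
Proof. by rewrite /scale -mulrnA mulnC. Qed.

Fact nat_scale0 v : scale 0 v = 0. Proof. exact: mulr0n. Qed.

Fact nat_scale1 : left_id 1 scale. Proof. exact: mulr1n. Qed.

Fact nat_scaleDr : right_distributive scale +%R.
Proof. by move=> n u v; rewrite /scale mulrnDl. Qed.

Fact nat_scaleDl v : {morph scale^~ v : a b / a + b}.
Proof. by move=> a b; rewrite /scale mulrnDr. Qed.

HB.instance Definition _ := GRing.Nmodule_isLSemiModule.Build nat nat_module
  nat_scaleA nat_scale0 nat_scale1 nat_scaleDr nat_scaleDl.

Lemma nat_scaleE (n : nat) (v : nat_module) : n *: v = v *+ n.
Proof. by []. Qed.

End NatModule.

(** * The module of all sequences of natural numbers *)

Section NatSequences.

Let V : lSemiModType nat := nat_module (nat -> nat).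

Lemma nat_generated_by_units : additively_generated_by_units nat.
Proof.
move=> n; exists (nseq n 1); split=> [u|].
  by rewrite mem_nseq => /andP[_ /eqP->]; exists 1; rewrite mul1r.
by rewrite big_nseq iter_addr_0 natn.
Qed.

Lemma seq_lacks_zero_sums : lacks_zero_sums V.
Proof.
move=> f g fg0; have H i : f i = 0 /\ g i = 0.
  have /eqP := congr1 (fun h : nat -> nat => h i) fg0.
  by rewrite addn_eq0 => /andP[/eqP ? /eqP].
by split; apply/funext => i; case: (H i).
Qed.

Definition line (i : nat) : set V :=
  [set f : nat -> nat | forall j, j <> i -> f j = 0].

Definition hyperplane (i : nat) : set V := [set f : nat -> nat | f i = 0].

Definition delta (i : nat) : V := fun j => nat_of_bool (j == i).

Lemma seqZE (n : nat) (f : V) (i : nat) : (n *: f) i = (n * f i)%N.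
Proof. by rewrite nat_scaleE natmulfctE -mulr_natl natn. Qed.

Lemma line_delta (i : nat) : line i (delta i).
Proof. by move=> j ji; rewrite /delta; case: eqP. Qed.

Lemma delta_neq0 (i : nat) : delta i <> 0.
Proof. by move=> /(congr1 (fun h : nat -> nat => h i)); rewrite /delta eqxx. Qed.

Lemma lineE (i : nat) (f : V) : line i f -> f = f i *: delta i.
Proof.
move=> fi; apply/funext => j; rewrite seqZE /delta.
by case: eqP => [->|/fi ->]; rewrite ?muln1 ?muln0.
Qed.

Lemma absorbing_delta (S : set V) (f : V) (i : nat) :
  summand_absorbing S -> S f -> f i <> 0 -> S (delta i).
Proof.
(* Truncated subtraction is exact here, since [f i] is at least 1. *)
move=> Sabs Sf fi0; apply: (Sabs _ (fun j => f j - delta i j)%N).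
suff -> : delta i + (fun j => f j - delta i j)%N = f by [].
apply/funext => j; apply: subnKC; rewrite /delta.
by case: eqP => // ->; rewrite lt0n; apply/eqP.
Qed.

Lemma line_dsum (i : nat) : is_dsum setT (line i) (hyperplane i).
Proof.
split=> //.
- apply/is_submoduleP; split=> // [f g fi gi|n f fi] j ji.
    by rewrite addrfctE fi ?gi.
  by rewrite seqZE fi ?muln0.
- apply/is_submoduleP; split=> // [f g|n f]; rewrite /hyperplane/=.
    by rewrite addrfctE => -> ->.
  by rewrite seqZE => ->; rewrite muln0.
move=> f _; exists ((fun j => if j == i then f j else 0),
                    (fun j => if j == i then 0 else f j)); split=> /=.
  split; first by move=> j; case: eqP.
    by rewrite /hyperplane/= eqxx.
  by apply/funext => j; rewrite addrfctE; case: eqP; rewrite ?addr0 ?add0r.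
move=> [g h] /= [gi hi ->]; congr pair; apply/funext => j; rewrite addrfctE.
  by case: eqP => [->|/gi ->//]; rewrite (hi : h i = 0) addr0.
by case: eqP => [->//|/gi ->]; rewrite add0r.
Qed.

(** In a splitting [delta i = a + b] the entries at [i] add up to 1, so [a] or [b] is [delta i]. The
    part containing it is the whole line, and the other part is 0. *)
Lemma line_indecomposable (i : nat) : indecomposable (line i).
Proof.
split; first by case: (line_dsum i).
  by move=> li; apply: (delta_neq0 (i := i)); have := line_delta (i := i); rewrite li.
move=> [W1 [W2 [dW W10 W20]]].
have [/is_submoduleP[W1_0 _ W1Z] /is_submoduleP[W2_0 _ W2Z] W1l W2l uniqW] := dW.
have cap0 f : W1 f -> W2 f -> f = 0.
  move=> W1f W2f; have [p [_ uniqp]] := uniqW _ (W1l _ W1f).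
  have e1 := uniqp (f, 0) (And3 W1f W2_0 (esym (addr0 _))).
  have e2 := uniqp (0, f) (And3 W1_0 W2f (esym (add0r _))).
  by have [-> _] : (f, 0 : V) = (0, f) by rewrite -e1 -e2.
have zero (W W' : set V) : W `<=` line i -> W 0 -> W' (delta i) ->
    (forall a v, W' v -> W' (a *: v)) -> (forall f, W f -> W' f -> f = 0) ->
    W = [set 0].
  move=> Wl W0 Wd WZ cap; apply/seteqP; split=> [f Wf|f ->//].
  by apply: cap => //; rewrite (lineE (Wl _ Wf)); apply: WZ.
have [a [b [W1a W2b e]]] := dsum_split dW (line_delta (i := i)).
have ai : line i a := W1l _ W1a.
have bi : line i b := W2l _ W2b.
have : (a i + b i)%N = 1%N.
  have := congr1 (fun h : nat -> nat => h i) e.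
  by rewrite /delta eqxx addrfctE => /esym.
(* Only the entries (0, 1) and (1, 0) survive. *)
case ea: (a i) => [|[|n]]; case eb: (b i) => [|m]//.
- rewrite add0n => -[m0]; apply: W10; apply: (zero _ W2) => //.
  suff -> : delta i = b by [].
  by rewrite (lineE bi) eb m0 scale1r.
- move=> _; apply: W20; apply: (zero _ W1) => // [|f W2f W1f]; last exact: cap0.
  suff -> : delta i = a by [].
  by rewrite (lineE ai) ea scale1r.
Qed.

Lemma line_indec_summand (i : nat) : indec_summands V (line i).
Proof.
split; last exact: line_indecomposable.
by exists (hyperplane i); apply: line_dsum.
Qed.

(** An indecomposable summand with a nonzero element absorbs some [delta i], hence equals [line i];
    adding one of its elements alters only the entry at [i]. *)
Lemma dsoc_finite_support (f : V) :
  dsoc V f -> exists n, forall m, (n <= m)%N -> f m = 0.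
Proof.
move: f; apply: family_sum_ind => [|T f g DT Tf [n gn]]; first by exists 0%N.
have [->|f0] := pselect (f = 0); first by exists n => m /gn; rewrite add0r.
have [i fi] : exists i, f i <> 0.
  apply: contrapT => H; apply: f0; apply/funext => i.
  by apply: contrapT => fi; apply: H; exists i.
have Td : T (delta i).
  apply: absorbing_delta Tf fi.
  exact: (indec_summand_absorbing seq_lacks_zero_sums DT).
have eT : T = line i.
  apply: (indec_summand_eq seq_lacks_zero_sums DT (line_indec_summand i) Td).
    exact: line_delta.
  exact: delta_neq0.
exists (maxn n i.+1) => m; rewrite geq_max => /andP[nm im].
have fi' : line i f by rewrite -eT.
by rewrite addrfctE gn// fi'// => mi; rewrite mi ltnn in im.
Qed.

(** The coordinate lines are pairwise distinct. *)
Lemma infinite_indec_summands : infinite_set (indec_summands V).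
Proof.
move=> fin; apply: infinite_nat.
have -> : [set: nat] = line @^-1` indec_summands V.
  by apply/seteqP; split=> // i _; exact: line_indec_summand.
apply: finite_preimage fin => i j _ _ eij; apply: contrapT => ij.
have := line_delta (i := i); rewrite eij => /(_ _ ij).
by rewrite /delta eqxx.
Qed.

Lemma dsoc_not_direct_summand : ~ direct_summand (dsoc V).
Proof.
move=> [W dW].
have W0 w : W w -> w = 0.
  move=> Ww; apply/funext => i; apply: contrapT => wi.
  apply: (delta_neq0 (i := i)); apply: (dsum_capI dW).
    apply: (sub_family_sum (@indec_summand_submodule _ _) (line_indec_summand i)).
    exact: line_delta.
  apply: absorbing_delta Ww wi.
  exact: (dsum_summand_absorbing seq_lacks_zero_sums (dsumC dW)).
(* With a zero complement the constant sequence 1 would lie in the socle, but its support is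
   infinite. *)
have [d [w [+ /W0 w0 e]]] := dsum_split dW (I : setT ((fun=> 1%N) : V)).
rewrite w0 addr0 in e; rewrite -e => /dsoc_finite_support[n /(_ n (leqnn n))].
by [].
Qed.

End NatSequences.

Theorem theorem2p17 :
  (forall (R : pzSemiRingType) (V : lSemiModType R),
      additively_generated_by_units R -> lacks_zero_sums V ->
      is_family_dsum (indec_summands V) id (dsoc V)
      /\ is_submodule (dsoc0' V))
  /\
  (exists (R : pzSemiRingType) (V : lSemiModType R),
      [/\ additively_generated_by_units R,
          lacks_zero_sums V,
          infinite_set (indec_summands V) &
          ~ direct_summand (dsoc V)]).
Proof.
split=> [R V gen lzs|].
  split; last exact: dsoc0'_submodule.
  by split=> //; exact: indec_summands_direct.
exists nat, (nat_module (nat -> nat)); split.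
- exact: nat_generated_by_units.
- exact: seq_lacks_zero_sums.
- exact: infinite_indec_summands.
- exact: dsoc_not_direct_summand.
Qed.
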